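(* Let $r\ge 2$ and $1\le q\le r$ be integers. Suppose that we are given positive reals $t_1,\dots,t_q$ and positive integers $s_1,\dots,s_r,t_{q+1},\dots,t_r$ such that $t_i\ge s_i$ for all $i\in\{q+1,\dots,r\}$. Let $$\mathbf F=(\mathbf k_{s_1,t_1},\dots,\mathbf k_{s_q,t_q},K_{s_{q+1},t_{q+1}},\dots,K_{s_r,t_r}).$$ Then there exist a positive integer $s$ and a real $t>0$ such that $\mathbf k_{s,t}\to\mathbf F$ and $\hat r(\mathbf F)=e(\mathbf k_{s,t})=st$.
   Context: Notation: $[r]=\{1,\dots,r\}$; $2^X$ is the set of all subsets of $X$; $\subset$ allows equality. All graphs are finite and simple; $K_{m,n}$ is the complete bipartite graph with parts of sizes $m$ and $n$. Weights. A weight $\mathbf f$ on a finite nonempty set $V(\mathbf f)$ is a family $(f_A)_{A\in 2^{V(\mathbf f)}}$ of non-negative reals. Its order is $v(\mathbf f)=|V(\mathbf f)|$ and its size is $e(\mathbf f)=\sum_{A} f_A|A|$. For a positive integer $s$ and real $t>0$, $\mathbf k_{s,t}$ is the weight on $[s]$ which has value $t$ on the set $[s]$ and value $0$ on every other subset of $[s]$. Containment of a graph in a weight. For a bipartite graph $F$ and a weight $\mathbf g$, $F\subset\mathbf g$ means that for some bipartition $V(F)=V_1(F)\cup V_2(F)$ there is an injection $h:V_1(F)\to V(\mathbf g)$ such that for any $A\subset V_1(F)$ dominated by a vertex of $V_2(F)$ (i.e. $A\subset\Gamma_F(y)$ for some $y\in V_2(F)$, where $\Gamma_F(y)$ is the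 neighbourhood of $y$) there is $B\subset V(\mathbf g)$ with $h(A)\subset B$ and $g_B>0$. Containment of weights. For weights $\mathbf f,\mathbf g$ (if $v(\mathbf f)>v(\mathbf g)$, first enlarge $V(\mathbf g)$ by new vertices, letting $\mathbf g$ be zero on all new sets), $\mathbf f\subset\mathbf g$ means that there are an injection $h:V(\mathbf f)\to V(\mathbf g)$ and reals $w_{AB}\ge0$ ($A\in2^{V(\mathbf f)}$, $B\in2^{V(\mathbf g)}$) such that $w_{AB}=0$ whenever $h(A)\not\subset B$; $\sum_{B\supset h(A)}w_{AB}\ge f_A$ for all $A$; and $\sum_{A:\,h(A)\subset B}w_{AB}\le g_B$ for all $B$. Colourings of weights. An $r$-colouring $\mathbf c$ of a weight $\mathbf g$ is a family $(c_{A_1,\dots,A_r})$ of non-negative reals indexed by $r$-tuples of pairwise disjoint subsets of $V(\mathbf g)$ such that $\sum_{A_1\cup\dots\cup A_r=A}c_{A_1,\dots,A_r}>g_A$ for all $A\in2^{V(\mathbf g)}$. Its $i$-th colour subweight $\mathbf c_i$ is the weight on $V(\mathbf g)$ with $c_{i,A}=\sum_{(A_1,\dots,A_r):\,A_i=A}c_{A_1,\dots,A_r}$. Arrowing for weights. For $\mathbf F=(\mathbf F_1,\dots,\mathbf F_r)$, with $\mathbf F_i$ a weight for $i\le q$ and a bipartite graph for $i>q$, $\mathbf g\to\mathbf F$ means that for every $r$-colouring $\mathbf c$ of $\mathbf g$ we have $\mathbf F_i\subset\mathbf c_i$ for some $i\in[r]$. Finally $\hat r(\mathbf F)=\inf\{e(\mathbf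 g):\mathbf g\text{ is a weight},\ \mathbf g\to\mathbf F\}$. *)

(* Defs.v *)
From HB Require Import structures.
From mathcomp Require Import all_boot all_order all_algebra.
From mathcomp Require Import all_classical all_reals ereal.

Set Implicit Arguments.
Unset Strict Implicit.
Unset Printing Implicit Defensive.

Import Order.TTheory GRing.Theory Num.Theory.
Local Open Scope ring_scope.

Record sgraph := SGraph {
  vertex :> finType;
  adj : rel vertex;
  adj_sym : symmetric adj;
  adj_irr : irreflexive adj }.

Definition neighbours (G : sgraph) (y : G) : {set G} := [set x | adj y x]%SET.

Definition bipartition (G : sgraph) (V1 V2 : {set G}) : Prop :=
  [/\ V1 :|: V2 = [set: G]%SET, [disjoint V1 & V2],
      {in V1 &, forall x y, ~~ adj x y} & {in V2 &, forall x y, ~~ adj x y}].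

Definition Kmn_adj (m n : nat) : rel ('I_m + 'I_n)%type := fun x y =>
  match x, y with
  | inl _, inr _ | inr _, inl _ => true
  | _, _ => false
  end.

Lemma Kmn_adj_sym m n : symmetric (@Kmn_adj m n).
Proof. by case=> ? [] ?. Qed.

Lemma Kmn_adj_irr m n : irreflexive (@Kmn_adj m n).
Proof. by case. Qed.

Definition Kmn (m n : nat) : sgraph :=
  SGraph (@Kmn_adj_sym m n) (@Kmn_adj_irr m n).

(* A weight with vertex set V is a function {set V} -> R satisfying is_weight;
   its order is #|V|. *)
Definition is_weight (R : realType) (V : finType) (f : {set V} -> R) : Prop :=
  (0 < #|V|)%N /\ forall A, 0 <= f A.

Definition weight_size (R : realType) (V : finType) (f : {set V} -> R) : R :=
  \sum_(A : {set V}) f A * #|A|%:R.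

(* The weight k_{s,t}, with 'I_s in the role of [s]. *)
Definition kweight (R : realType) (s : nat) (t : R) : {set 'I_s} -> R :=
  fun A => if A == [set: 'I_s]%SET then t else 0.
Arguments kweight {R} s t _.

(* g with k new vertices added, zero on every set containing a new vertex. *)
Definition enlarge (R : realType) (V : finType) (k : nat) (g : {set V} -> R) :
    {set (V + 'I_k)%type} -> R :=
  fun B => if [exists j : 'I_k, inr j \in B] then 0
           else g [set x | inl x \in B]%SET.
Arguments enlarge {R V} k g _.

Definition weight_embeds (R : realType) (V W : finType)
    (f : {set V} -> R) (g : {set W} -> R) : Prop :=
  exists (h : V -> W) (w : {set V} -> {set W} -> R),
    [/\ injective h,
        forall A B, 0 <= w A B,
        forall (A : {set V}) (B : {set W}), ~~ (h @: A \subset B) -> w A B = 0,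
        forall A : {set V}, f A <= \sum_(B : {set W} | h @: A \subset B) w A B
      & forall B : {set W}, \sum_(A : {set V} | h @: A \subset B) w A B <= g B].

(* Containment of weights. The subtraction is truncated, so that no vertex is
   added to g unless the order of f exceeds that of g. *)
Definition weight_sub (R : realType) (V W : finType)
    (f : {set V} -> R) (g : {set W} -> R) : Prop :=
  weight_embeds f (enlarge (#|V| - #|W|)%N g).

(* Containment of a graph in a weight. Only the values of h on V1 matter. The
   graph is not required to be bipartite beforehand: a graph without a
   bipartition is contained in no weight. *)
Definition graph_sub (R : realType) (F : sgraph) (W : finType)
    (g : {set W} -> R) : Prop :=
  exists (V1 V2 : {set F}) (h : F -> W),
    [/\ bipartition V1 V2,
        {in V1 &, injective h}
      & forall A : {set F}, A \subset V1 ->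
          (exists2 y, y \in V2 & A \subset neighbours y) ->
          exists2 B : {set W}, h @: A \subset B & 0 < g B].

Inductive target (R : realType) : Type :=
  | WeightTarget (V : finType) (f : {set V} -> R)
  | GraphTarget (F : sgraph).
Arguments GraphTarget {R} F.

Definition target_sub (R : realType) (F : target R) (W : finType)
    (g : {set W} -> R) : Prop :=
  match F with
  | WeightTarget _ f => weight_sub f g
  | GraphTarget F => graph_sub F g
  end.

Definition disjoint_tuple (r : nat) (V : finType) (T : {ffun 'I_r -> {set V}}) :
    bool :=
  [forall i, forall j, (i != j) ==> [disjoint T i & T j]].

(* The values of c on tuples that are not pairwise disjoint are irrelevant: they
   occur neither here nor in colour. *)
Definition is_colouring (R : realType) (r : nat) (V : finType)
    (g : {set V} -> R) (c : {ffun 'I_r -> {set V}} -> R) : Prop :=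
  (forall T, disjoint_tuple T -> 0 <= c T) /\
  (forall A, g A < \sum_(T : {ffun 'I_r -> {set V}} |
                      disjoint_tuple T && ((\bigcup_i T i)%SET == A)) c T).

Definition colour (R : realType) (r : nat) (V : finType)
    (c : {ffun 'I_r -> {set V}} -> R) (i : 'I_r) : {set V} -> R :=
  fun A => \sum_(T : {ffun 'I_r -> {set V}} |
              disjoint_tuple T && (T i == A)) c T.

Definition arrows (R : realType) (r : nat) (V : finType)
    (g : {set V} -> R) (F : 'I_r -> target R) : Prop :=
  forall c : {ffun 'I_r -> {set V}} -> R, is_colouring g c ->
    exists i, target_sub (F i) (colour c i).

(* The infimum is taken in the extended reals: it is +oo if no g arrows F. *)
Definition rhat (R : realType) (r : nat) (F : 'I_r -> target R) : \bar R :=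
  ereal_inf [set x | exists (V : finType) (g : {set V} -> R),
    [/\ is_weight g, arrows g F & x = (weight_size g)%:E]]%classic.

(* Main.v *)
(** A weight [k_{s,t}] is contained in [g] when some [s]-set [S] has at least [t]
    as the sum of the [g B] over the [B] containing [S], and [K_{s,t}], for
    [s <= t], is contained in [g] when [g B > 0] for some [B] with at least [s]
    elements. Let [m] be the infimum of [a u] over the [k_{a,u}] which arrow [F].
    It is attained: [k_{a,u} -> F] forces [u >= t_1], so only finitely many [a]
    compete, and for a fixed [a] the set of suitable [u] contains its infimum.
    Conversely, a weight [g] of size less than [m] does not arrow [F]: every
    [A] has a colouring of some [k_{|A|,u}], [u < m/|A|], that avoids [F], and
    gluing the copies of these on the sets [A], scaled by about [g_A |A| / m],
    gives a colouring of [g] that avoids [F], since the scaling factors add up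
    to [1]. *)

Require Import Defs.
From HB Require Import structures.
From mathcomp Require Import all_boot all_order all_algebra.
From mathcomp Require Import all_classical all_reals ereal.
Import Order.TTheory GRing.Theory Num.Theory.
Local Open Scope ring_scope.

Set Implicit Arguments.
Unset Strict Implicit.
Unset Printing Implicit Defensive.

(** * Containment of [k_{s,t}] and [K_{s,n}] in a weight *)

Lemma weight_size_kweight (R : realType) (s : nat) (t : R) :
  weight_size (kweight s t) = s%:R * t.
Proof.
rewrite /weight_size (bigD1 [set: 'I_s]%SET) //= big1 ?addr0.
  by rewrite /kweight eqxx cardsT card_ord mulrC.
by move=> A /negPf A_neq; rewrite /kweight A_neq mul0r.
Qed.

(** Sets with a new vertex carry zero, and the others are the images [inl @: B] of the old sets. *)
Lemma sum_enlarge (R : realType) (W : finType) (k : nat) (g : {set W} -> R)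
    (P : pred {set W}) :
  \sum_(B : {set (W + 'I_k)%type} | P [set x | inl x \in B]%SET) enlarge k g B =
  \sum_(B | P B) g B.
Proof.
rewrite (bigID (fun B : {set (W + 'I_k)%type} => [exists j : 'I_k, inr j \in B])).
rewrite /= big1 ?add0r; last by move=> B /andP[_ exj]; rewrite /enlarge exj.
pose lift (B : {set W}) : {set (W + 'I_k)%type} := (inl @: B)%SET.
have liftK B : [set x | inl x \in lift B]%SET = B.
  by apply/setP => x; rewrite inE mem_imset // => ? ? [].
have noinr B : ~~ [exists j : 'I_k, inr j \in lift B].
  by apply/existsPn => j; apply/imsetP => -[].
rewrite (reindex_onto lift (fun B => [set x | inl x \in B]%SET)) /=; last first.
  move=> B /andP[_ /existsPn noB]; apply/setP => -[x|j].
    by rewrite mem_imset ?inE // => ? ? [].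
  by rewrite (negPf (noB j)); apply/imsetP => -[].
apply: eq_big => [B|B _]; first by rewrite liftK noinr eqxx !andbT.
by rewrite /enlarge (negPf (noinr B)) liftK.
Qed.

(** Only the full set of [kweight s t] demands anything, so only its row of [w] matters, and [S] is
    the image of [h]. *)
Lemma kweight_subP (R : realType) (s : nat) (t : R) (W : finType)
    (g : {set W} -> R) : 0 < t -> (forall B, 0 <= g B) ->
  weight_sub (kweight s t) g <->
  exists2 S : {set W}, #|S| = s & t <= \sum_(B : {set W} | S \subset B) g B.
Proof.
move=> t_gt0 g_ge0; split.
  rewrite /weight_sub; set k := (_ - _)%N => -[h [w [h_inj w_ge0 _ w_out w_in]]].
  have le_t : t <= \sum_(B : {set (W + 'I_k)%type} | h @: [set: 'I_s] \subset B)
                      enlarge k g B.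
    have := w_out [set: 'I_s]%SET; rewrite /kweight eqxx => /le_trans; apply.
    apply: ler_sum => B hB; apply: le_trans (w_in B).
    by rewrite (bigD1 [set: 'I_s]%SET) //= lerDl sumr_ge0.
  (* If [h] hit a new vertex, every set containing its image would carry zero, against [0 < t]. *)
  have h_inl i : exists x, h i = inl x.
    case hi : (h i) => [x|j]; first by exists x.
    suff : t <= 0 by rewrite leNgt t_gt0.
    apply: le_trans le_t _; rewrite big1 // => B /fintype.subsetP hB.
    rewrite /enlarge ifT //; apply/existsP; exists j.
    by apply: hB; rewrite -hi imset_f // inE.
  pose h' i := projT1 (cid (h_inl i)).
  have hE i : h i = inl (h' i) by rewrite /h'; case: cid.
  have h'_inj : injective h' by move=> i j ij; apply: h_inj; rewrite !hE ij.
  exists (h' @: [set: 'I_s])%SET; first by rewrite card_imset // cardsT card_ord.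
  rewrite -(sum_enlarge k g (fun B => (h' @: [set: 'I_s] \subset B)%SET)).
  apply: le_trans le_t _; rewrite le_eqVlt; apply/orP; left; apply/eqP.
  apply: eq_bigl => B; apply/fintype.subsetP/fintype.subsetP => hB x /imsetP[i _ ->].
    by rewrite inE -hE hB // imset_f // inE.
  by rewrite hE; have := hB (h' i) (imset_f _ (finset.in_setT _)); rewrite inE.
case=> S cardS le_t; rewrite /weight_sub; set k := (_ - _)%N.
pose h (i : 'I_s) : (W + 'I_k)%type := inl (enum_val (cast_ord (esym cardS) i)).
have h_inj : injective h by move=> i j [] /enum_val_inj /cast_ord_inj.
have hSE (B : {set (W + 'I_k)%type}) : (h @: [set: 'I_s] \subset B)%SET =
             (S \subset [set x | inl x \in B]%SET).
  apply/fintype.subsetP/fintype.subsetP => [hB x Sx|SB _ /imsetP[i _ ->]]; last first.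
    by have := SB _ (enum_valP (cast_ord (esym cardS) i)); rewrite inE.
  rewrite inE; apply: hB; apply/imsetP.
  exists (cast_ord cardS (enum_rank_in Sx x)); rewrite ?inE // /h cast_ordK.
  by rewrite enum_rankK_in.
have g'_ge0 B : 0 <= enlarge k g B by rewrite /enlarge; case: ifP.
(* The full set takes all the weight of every set above its image; the other rows are zero. *)
exists h, (fun A (B : {set (W + 'I_k)%type}) =>
  if (A == [set: 'I_s]%SET) && (h @: A \subset B) then enlarge k g B else 0).
split=> // [A B|A B|A|B].
- by case: ifP.
- by move/negPf=> ->; rewrite andbF.
- rewrite /kweight; case: eqP => [->|_]; last by rewrite sumr_ge0.
  rewrite (eq_bigr (enlarge k g)) => [|B -> //].
  by rewrite (eq_bigl _ _ hSE) (sum_enlarge k g (fun B => S \subset B)).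
- rewrite big_mkcond (bigD1 [set: 'I_s]%SET) //= big1 ?addr0.
    by rewrite eqxx /=; case: ifP => hB; rewrite ?hB ?g'_ge0.
  by move=> A /negPf A_neq; rewrite A_neq; case: ifP.
Qed.

(** In any bipartition [V1] contains a whole side, dominated by a vertex of the other side that lies
    in [V2]. This gives a [B] with at least [s] or at least [n] elements, and [s <= n] makes [s] the
    weaker demand. The converse takes the side of size [s] as [V1]. *)
Lemma Kmn_subP (R : realType) (s n : nat) (W : finType) (g : {set W} -> R) :
  (0 < s)%N -> (s <= n)%N ->
  graph_sub (Kmn s n) g <-> exists2 B : {set W}, (s <= #|B|)%N & 0 < g B.
Proof.
move=> s_gt0 le_sn; have n_gt0 := leq_trans s_gt0 le_sn.
pose x0 : Kmn s n := inl (Ordinal s_gt0).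
pose y0 : Kmn s n := inr (Ordinal n_gt0).
split=> [[V1 [V2 [h [[VT _ V1i V2i] h_inj dom]]]]|[B le_sB gB]].
  have [sub_V1|sub_V2] : (forall i, (inl i : Kmn s n) \in V1) /\ y0 \in V2 \/
                         (forall i, (inr i : Kmn s n) \in V1) /\ x0 \in V2.
  - have VP x : x \in V1 \/ x \in V2 by apply/setUP; rewrite VT inE.
    have [x0V|x0V] := VP x0.
      have y0V : y0 \in V2.
        by have [/(V1i _ _ x0V)|] := VP y0.
      by left; split=> // i; have [|/(V2i _ _ y0V)] := VP (inl i).
    by right; split=> // i; have [|/(V2i _ _ x0V)] := VP (inr i).
  - case: sub_V1 => sub_V1 y0V.
    have lV : (inl @: [set: 'I_s] : {set Kmn s n})%SET \subset V1.
      by apply/fintype.subsetP => _ /imsetP[i _ ->].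
    have [|B hB gB] := dom _ lV.
      by exists y0 => //; apply/fintype.subsetP => _ /imsetP[i _ ->]; rewrite inE.
    exists B => //; apply: leq_trans (subset_leq_card hB).
    rewrite card_in_imset; last first.
      by move=> x y /(fintype.subsetP lV) xV /(fintype.subsetP lV) yV; apply: h_inj.
    by rewrite card_imset ?cardsT ?card_ord // => ? ? [].
  - case: sub_V2 => sub_V1 x0V.
    have rV : (inr @: [set: 'I_n] : {set Kmn s n})%SET \subset V1.
      by apply/fintype.subsetP => _ /imsetP[i _ ->].
    have [|B hB gB] := dom _ rV.
      by exists x0 => //; apply/fintype.subsetP => _ /imsetP[i _ ->]; rewrite inE.
    exists B => //; apply: leq_trans (subset_leq_card hB).
    rewrite card_in_imset; last first.
      by move=> x y /(fintype.subsetP rV) xV /(fintype.subsetP rV) yV; apply: h_inj.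
    by rewrite card_imset ?cardsT ?card_ord // => ? ? [].
pose e (i : 'I_s) : W := enum_val (widen_ord le_sB i).
have e_inj : injective e by move=> i j /enum_val_inj [] /val_inj.
(* Only the values on the side of size [s] count; the other side gets an arbitrary vertex. *)
pose h (x : Kmn s n) : W := if x is inl i then e i else e (Ordinal s_gt0).
exists [set x | if x is inl _ then true else false]%SET.
exists [set x | if x is inl _ then false else true]%SET, h; split.
- split.
  + by apply/setP => -[x|x]; rewrite !inE.
  + by rewrite -setI_eq0; apply/eqP/setP => -[x|x]; rewrite !inE.
  + by move=> [x|x] [y|y]; rewrite !inE.
  + by move=> [x|x] [y|y]; rewrite !inE.
- by move=> [x|x] [y|y]; rewrite ?inE // => _ _ /e_inj ->.
- move=> A _ _; exists B => //; apply/fintype.subsetP => _ /imsetP[x _ ->].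
  by case: x => [i|j]; apply: enum_valP.
Qed.

(** * Colour subweights and monotonicity of arrowing *)

Lemma sum_colour (R : realType) (r : nat) (V : finType)
    (c : {ffun 'I_r -> {set V}} -> R) (i : 'I_r) (S : {set V}) :
  \sum_(B : {set V} | S \subset B) colour c i B =
  \sum_(T : {ffun 'I_r -> {set V}} | disjoint_tuple T && (S \subset T i)) c T.
Proof.
rewrite [RHS](partition_big (fun T : {ffun 'I_r -> {set V}} => T i)
                            (fun B => S \subset B)) /=; last by move=> T /andP[].
apply: eq_bigr => B SB; apply: eq_bigl => T.
by case: eqP => [->|_]; rewrite ?SB ?andbT ?andbF.
Qed.

Lemma colour_ge0 (R : realType) (r : nat) (V : finType) (g : {set V} -> R)
    (c : {ffun 'I_r -> {set V}} -> R) (i : 'I_r) :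
  is_colouring g c -> forall B, 0 <= colour c i B.
Proof. by case=> c_ge0 _ B; apply: sumr_ge0 => T /andP[/c_ge0]. Qed.

Lemma colour_gt0 (R : realType) (r : nat) (V : finType) (g : {set V} -> R)
    (c : {ffun 'I_r -> {set V}} -> R) (i : 'I_r) (B : {set V}) :
  is_colouring g c ->
  0 < colour c i B <-> exists2 T, disjoint_tuple T & T i = B /\ 0 < c T.
Proof.
move=> [c_ge0 _]; split=> [|[T dT [<- cT]]].
  rewrite lt_def => /andP[+ _]; rewrite psumr_neq0; last by move=> T /andP[/c_ge0].
  by case/hasP => T _ /andP[/andP[dT /eqP TB] cT]; exists T.
rewrite /colour (bigD1 T) ?dT ?eqxx //= ltr_wpDr // sumr_ge0 //.
by move=> U /andP[/andP[/c_ge0]].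
Qed.

(* Since every inequality in the definition of a colouring is strict, the values
   of [t] at which [kweight s t] arrows [F] are closed from below. *)
Lemma arrows_kweight_limit (R : realType) (r s : nat) (t : R)
    (F : 'I_r -> target R) :
  (forall u, t < u -> exists2 v, v < u & arrows (kweight s v) F) ->
  arrows (kweight s t) F.
Proof.
move=> lim c [c_ge0 gt_c].
(* This total exceeds [t], so it can serve as [u]; then [c] also colours [kweight s v]. *)
have [|v lt_v] := lim (\sum_(T : {ffun 'I_r -> {set 'I_s}} |
    disjoint_tuple T && ((\bigcup_i T i)%SET == [set: 'I_s]%SET)) c T).
  by have := gt_c [set: 'I_s]%SET; rewrite /kweight eqxx.
apply; split=> // A; have := gt_c A; rewrite /kweight.
by case: eqP => [->|].
Qed.

Lemma arrows_le (R : realType) (r : nat) (V : finType) (g g' : {set V} -> R)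
    (F : 'I_r -> target R) :
  (forall A, g A <= g' A) -> arrows g F -> arrows g' F.
Proof.
move=> le_g g_F c [c_ge0 gt_c]; apply: g_F; split=> // A.
exact: le_lt_trans (gt_c A).
Qed.

(** * Transport of tuples between a set [A] and ['I_#|A|] *)

Section Pullback.
Variables (r : nat) (V : finType) (A : {set V}).
Implicit Types (T : {ffun 'I_r -> {set V}}) (U : {ffun 'I_r -> {set 'I_#|A|}}).

(** Colourings of [kweight #|A| u] live on ['I_#|A|]; the enumeration of [A] carries tuples across.
    Points outside [A] are lost. *)
Definition tuple_pullback T : {ffun 'I_r -> {set 'I_#|A|}} :=
  [ffun i => (@enum_val V (mem A)) @^-1: T i]%SET.

Definition tuple_pushforward U : {ffun 'I_r -> {set V}} :=
  [ffun i => (@enum_val V (mem A)) @: U i]%SET.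

Lemma tuple_pushforwardK : cancel tuple_pushforward tuple_pullback.
Proof.
move=> U; apply/ffunP => i; rewrite !ffunE; apply/setP => x.
by rewrite inE mem_imset //; exact: enum_val_inj.
Qed.

Lemma enum_val_preimsetK (S : {set V}) : S \subset A ->
  ((@enum_val V (mem A)) @: ((@enum_val V (mem A)) @^-1: S) = S)%SET.
Proof.
move=> /fintype.subsetP SA; apply/setP => x; apply/imsetP/idP => [[y + ->]|Sx].
  by rewrite inE.
by exists (enum_rank_in (SA _ Sx) x); rewrite ?inE enum_rankK_in ?SA.
Qed.

Lemma tuple_pullbackK T : \bigcup_i T i \subset A ->
  tuple_pushforward (tuple_pullback T) = T.
Proof.
move=> TA; apply/ffunP => i; rewrite !ffunE enum_val_preimsetK //.
exact: fintype.subset_trans (finset.bigcup_sup i _) TA.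
Qed.

Lemma disjoint_pushforward U : disjoint_tuple (tuple_pushforward U) = disjoint_tuple U.
Proof.
apply: eq_forallb => i; apply: eq_forallb => j; congr (_ ==> _).
by rewrite !ffunE imset_disjoint //; exact: enum_val_inj.
Qed.

Lemma bigcup_pushforward U :
  (\bigcup_i tuple_pushforward U i == A)%SET = (\bigcup_i U i == [set: 'I_#|A|])%SET.
Proof.
have <- : ((@enum_val V (mem A)) @: (\bigcup_i U i) = \bigcup_i tuple_pushforward U i)%SET.
  apply/setP => x; apply/imsetP/finset.bigcupP => [[y /finset.bigcupP[i _ Uy] ->]|].
    by exists i; rewrite // ffunE imset_f.
  case=> i _; rewrite ffunE => /imsetP[y Uy ->]; exists y => //.
  by apply/finset.bigcupP; exists i.
have valT : ((@enum_val V (mem A)) @: [set: 'I_#|A|] = A)%SET.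
  apply/setP => x; apply/imsetP/idP => [[y _ ->]|xA]; first exact: enum_valP.
  by exists (enum_rank_in xA x); rewrite ?inE ?enum_rankK_in.
by rewrite -[RHS](inj_eq (imset_inj (@enum_val_inj V (mem A)))) valT.
Qed.

(** The enumeration of [A] matches the disjoint tuples with union [A] and those with union ['I_#|A|]
    bijectively. *)
Lemma sum_pullback (R : nmodType) (P : pred {ffun 'I_r -> {set V}}) (f : _ -> R) :
  \sum_(T : {ffun 'I_r -> {set V}} |
      [&& disjoint_tuple T, (\bigcup_i T i == A)%SET & P T]) f (tuple_pullback T) =
  \sum_(U : {ffun 'I_r -> {set 'I_#|A|}} | [&& disjoint_tuple U,
      (\bigcup_i U i == [set: 'I_#|A|])%SET & P (tuple_pushforward U)]) f U.
Proof.
rewrite (reindex_onto tuple_pushforward tuple_pullback) /=.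
  apply: eq_big => [U|U _]; last by rewrite tuple_pushforwardK.
  by rewrite tuple_pushforwardK eqxx andbT disjoint_pushforward bigcup_pushforward.
by move=> T /and3P[_ /eqP TA _]; rewrite tuple_pullbackK // TA.
Qed.

End Pullback.

(** * Cardinalities of unions and subsets *)

Lemma card_bigcup_le (I V : finType) (T : I -> {set V}) :
  (#|\bigcup_i T i| <= \sum_i #|T i|)%N.
Proof.
elim/big_rec2: _ => [|i k S _ le_Sk]; first by rewrite cards0.
by rewrite (leq_trans (leq_card_setU _ _)) // leq_add2l.
Qed.

Lemma card_subset_exists (V : finType) (k : nat) (B : {set V}) : (k <= #|B|)%N ->
  exists2 S : {set V}, S \subset B & #|S| = k.
Proof.
rewrite -bin_gt0 -cards_draws => /card_gt0P[S]; rewrite inE => /andP[SB /eqP cardS].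
by exists S.
Qed.

(** * Lower bounds for weights that arrow a mixed family *)

Section MixedTargets.
Variables (R : realType) (r q : nat).
Variables (s : 'I_r -> nat) (t : 'I_r -> R) (n : 'I_r -> nat).
Hypothesis s_gt0 : forall i : 'I_r, (0 < s i)%N.
Hypothesis t_gt0 : forall i : 'I_r, (i < q)%N -> 0 < t i.
Hypothesis le_sn : forall i : 'I_r, (q <= i)%N -> (0 < n i)%N /\ (s i <= n i)%N.

Definition mixed_target (i : 'I_r) : target R :=
  if (i < q)%N then WeightTarget (kweight (s i) (t i))
  else GraphTarget (Kmn (s i) (n i)).

(** Containment of the [i]-th target with [h] and [w] eliminated, by [kweight_subP] and
    [Kmn_subP]. *)
Definition has_target (i : 'I_r) (W : finType) (g : {set W} -> R) : Prop :=
  if (i < q)%N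
  then exists2 S : {set W}, #|S| = s i & t i <= \sum_(B : {set W} | S \subset B) g B
  else exists2 B : {set W}, (s i <= #|B|)%N & 0 < g B.

Lemma arrows_mixedP (V : finType) (g : {set V} -> R) :
  arrows g mixed_target <->
  forall c, is_colouring g c -> exists i, has_target i (colour c i).
Proof.
suff sub_has c i : is_colouring g c ->
    target_sub (mixed_target i) (colour c i) <-> has_target i (colour c i).
  by split=> g_F c cP; have [i] := g_F c cP; exists i; apply/sub_has.
move=> cP; rewrite /mixed_target /has_target; case: ltnP => [lt_iq|/le_sn[_ le_n]].
  exact: (kweight_subP _ (t_gt0 lt_iq) (colour_ge0 i cP)).
exact: Kmn_subP.
Qed.

(* Tested on the colourings that use only the colour [i0]. *)
Lemma arrows_mixed_ge (i0 : 'I_r) (V : finType) (g : {set V} -> R) :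
  (i0 < q)%N -> (forall A, 0 <= g A) -> arrows g mixed_target ->
  (s i0 <= #|V|)%N /\ t i0 <= \sum_A g A.
Proof.
move=> lt_i0 g_ge0 /arrows_mixedP g_F.
(* A colouring must exceed [g] strictly on every set, hence a slack [e] per set, which is then let
   tend to zero. *)
suff le_t e : 0 < e ->
    (s i0 <= #|V|)%N /\ t i0 <= \sum_A g A + e *+ #|{set V}|.
  split; first by case: (le_t 1).
  apply/ler_addgt0Pr => e e_gt0; have card_gt0 : (0 < #|{set V}|)%N.
    by apply/card_gt0P; exists finset.set0.
  have [|_] := le_t (e / #|{set V}|%:R); first by rewrite divr_gt0 ?ltr0n.
  by rewrite -[_ / _ *+ _]mulr_natr divfK // pnatr_eq0 -lt0n.
move=> e_gt0; pose w A := g A + e.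
have w_gt0 A : 0 < w A by rewrite ltr_wpDl.
pose one (T : {ffun 'I_r -> {set V}}) := [forall j, (j != i0) ==> (T j == finset.set0)].
pose c (T : {ffun 'I_r -> {set V}}) : R := if one T then w (T i0) else 0.
have c_ge0 T : 0 <= c T by rewrite /c; case: ifP => // _; apply: ltW.
pose single (A : {set V}) : {ffun 'I_r -> {set V}} :=
  [ffun j => if j == i0 then A else finset.set0].
have singleE A : single A i0 = A by rewrite ffunE eqxx.
have one_single A : one (single A).
  by apply/forallP => j; apply/implyP => /negPf ji; rewrite ffunE ji.
have oneE T : one T -> T = single (T i0).
  move=> /forallP oneT; apply/ffunP => j; rewrite ffunE; case: eqP => [->//|/eqP ji].
  by have := oneT j; rewrite ji => /eqP.
have cP : is_colouring g c.
  split=> // A; rewrite (bigD1 (single A)) /=.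
    by rewrite {1}/c one_single singleE ltr_wpDr ?sumr_ge0 // ltrDl.
  apply/andP; split.
    apply/forallP => j; apply/forallP => k; apply/implyP => jk; rewrite !ffunE.
    case: (eqVneq j i0) => [ji|_]; last by rewrite -setI_eq0 finset.set0I.
    case: (eqVneq k i0) => [ki|_]; last by rewrite -setI_eq0 finset.setI0.
    by rewrite ji ki eqxx in jk.
  rewrite (bigD1 i0) //= singleE big1 ?finset.setU0 // => j /negPf ji.
  by rewrite ffunE ji.
(* Colours other than [i0] live on the empty set only, while every target needs a set of at least
   [s i > 0] elements. *)
have c_eq0 i (S : {set V}) (T : {ffun 'I_r -> {set V}}) :
    i != i0 -> (0 < #|S|)%N -> S \subset T i -> c T = 0.
  move=> ii0 S_gt0; rewrite /c; case: ifP => // /oneE ->.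
  by rewrite ffunE (negPf ii0) finset.subset0 -cards_eq0 -leqn0 leqNgt S_gt0.
have [i] := g_F c cP; rewrite /has_target; case: ltnP => [lt_iq|le_qi]; last first.
  case=> B le_B /(colour_gt0 i B cP)[T _ [TB]]; rewrite (@c_eq0 i B) ?ltxx ?TB //.
    by apply: contraTneq le_qi => ->; rewrite -ltnNge.
  exact: leq_trans le_B.
case=> S cardS; rewrite sum_colour; case: (eqVneq i i0) => [ii0|ii0]; last first.
  rewrite big1 => [|T /andP[_ /c_eq0->//]]; last by rewrite cardS.
  by move/lt_le_trans => /(_ _ (t_gt0 lt_iq)); rewrite ltxx.
subst i; split; first by rewrite -cardS max_card.
apply: le_trans (le_trans _ (_ : \sum_A w A <= _)); first eassumption; last first.
  by rewrite big_split /= sumr_const.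
rewrite (partition_big (fun T : {ffun 'I_r -> {set V}} => T i0) xpredT) //=.
apply: ler_sum => B _.
have w_ge0 : 0 <= w B by apply: ltW.
rewrite big_mkcond (bigD1 (single B)) //= big1 ?addr0.
  by rewrite /c one_single singleE; case: ifP.
move=> T T_neq; case: ifP => // /andP[_ /eqP TB]; rewrite /c; case: ifP => // /oneE.
by rewrite TB => /eqP; rewrite (negPf T_neq).
Qed.

(* The copy of the colouring for [A] is scaled by [lam A] and used on the tuples
   with union [A], so that no two copies overlap. The summand [e] of [lam A]
   also serves the sets [A] with [g A = 0], whose tuples must receive a positive
   total. *)
Lemma weight_size_mixed_ge (m : R) (V : finType) (g : {set V} -> R) :
  0 < m -> (forall a u, arrows (kweight a u) mixed_target -> m <= a%:R * u) ->
  (forall A, 0 <= g A) -> arrows g mixed_target -> m <= weight_size g.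
Proof.
move=> m_gt0 le_m g_ge0 /arrows_mixedP g_F; rewrite leNgt; apply/negP => lt_m.
have card_gt0 : 0 < #|{set V}|%:R :> R.
  by rewrite ltr0n; apply/card_gt0P; exists finset.set0.
(* Chosen so that the factors [lam A] sum to [1]; positive because the size of [g] is less than
   [m]. *)
pose e := (1 - weight_size g / m) / #|{set V}|%:R.
have e_gt0 : 0 < e by rewrite divr_gt0 // subr_gt0 ltr_pdivrMr ?mul1r.
pose lam A := g A * #|A|%:R / m + e.
have lam_gt0 A : 0 < lam A.
  by rewrite ltr_wpDl // divr_ge0 ?mulr_ge0 ?ler0n // ltW.
have sum_lam : \sum_A lam A = 1.
  rewrite big_split /= -mulr_suml sumr_const -[e *+ _]mulr_natr /e divfK ?gt_eqF //.
  by rewrite -/(weight_size g) addrC subrK.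
(* Since [lam A > g A * #|A| / m], the size [#|A| * g A / lam A] is less than [m], so this weight
   cannot arrow the family. *)
have avoid (A : {set V}) : exists c, is_colouring (kweight #|A| (g A / lam A)) c /\
    forall i, ~ has_target i (colour c i).
  apply: contrapT => no; suff /le_m : arrows (kweight #|A| (g A / lam A)) mixed_target.
    rewrite mulrA ler_pdivlMr // /lam mulrDr mulrCA divff ?gt_eqF // mulr1.
    by rewrite mulrC gerDl leNgt mulr_gt0.
  apply/arrows_mixedP => c cP; apply: contrapT => no_i; apply: no.
  by exists c; split=> // i ci; apply: no_i; exists i.
pose c (A : {set V}) := projT1 (cid (avoid A)).
have cP (A : {set V}) : is_colouring (kweight #|A| (g A / lam A)) (c A).
  by rewrite /c; case: cid => ? [].
have c_avoid (A : {set V}) i : ~ has_target i (colour (c A) i).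
  by rewrite /c; case: cid => ? [].
have disjointK (T : {ffun 'I_r -> {set V}}) : disjoint_tuple T ->
    disjoint_tuple (tuple_pullback (\bigcup_i T i)%SET T).
  by rewrite -disjoint_pushforward tuple_pullbackK.
pose C (T : {ffun 'I_r -> {set V}}) : R :=
  lam (\bigcup_i T i)%SET * c (\bigcup_i T i)%SET (tuple_pullback (\bigcup_i T i)%SET T).
have CP : is_colouring g C.
  split=> [T dT|A].
    by rewrite mulr_ge0 ?(ltW (lam_gt0 _)) //; apply: (cP _).1; apply: disjointK.
  rewrite (eq_bigr (fun T : {ffun 'I_r -> {set V}} =>
    lam A * c A (tuple_pullback A T))); last first.
    by move=> T /andP[_ /eqP TA]; rewrite /C TA.
  rewrite -mulr_sumr -ltr_pdivrMl // mulrC.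
  have := (cP A).2 [set: 'I_#|A|]%SET; rewrite /kweight eqxx.
  have andbbT (b b' : bool) : b && b' = [&& b, b' & true] by rewrite andbT.
  move=> /lt_le_trans; apply; under eq_bigl do rewrite andbbT.
  under [leRHS]eq_bigl do rewrite andbbT.
  by have /= -> := sum_pullback (fun=> true) (c A).
have [i] := g_F C CP; rewrite /has_target; case: ltnP => [lt_iq|le_qi]; last first.
  (* A positive value of [C] comes from a positive value in a single copy, which would then contain
     the graph already. *)
  case=> B le_B /(colour_gt0 i B CP)[T dT [TB CT]].
  apply: (c_avoid (\bigcup_i T i)%SET i); rewrite /has_target ltnNge le_qi /=.
  exists (tuple_pullback (\bigcup_i T i)%SET T i); last first.
    apply/(colour_gt0 i _ (cP _)); exists (tuple_pullback (\bigcup_i T i)%SET T).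
      exact: disjointK.
    by split=> //; move: CT; rewrite /C pmulr_rgt0.
  rewrite ffunE -(card_imset _ (@enum_val_inj _ _)) enum_val_preimsetK ?TB //.
  by rewrite -TB; apply: finset.bigcup_sup.
case=> S cardS; rewrite sum_colour leNgt => /negP; apply.
(* Grouped by the union [A], this is a combination, with coefficients [lam A] of sum [1], of numbers
   less than [t i]. *)
rewrite (partition_big (fun T : {ffun 'I_r -> {set V}} => \bigcup_i T i)%SET xpredT) //=.
rewrite -[ltRHS]mul1r -sum_lam mulr_suml; apply: ltr_sum.
  by apply/hasP; exists finset.set0; rewrite ?mem_index_enum.
move=> A _; rewrite (eq_bigr (fun T : {ffun 'I_r -> {set V}} =>
    lam A * c A (tuple_pullback A T))); last first.
  by move=> T /andP[_ /eqP TA]; rewrite /C TA.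
rewrite -mulr_sumr ltr_pM2l //.
rewrite (eq_bigl (fun T : {ffun 'I_r -> {set V}} =>
    [&& disjoint_tuple T, (\bigcup_i T i == A)%SET & S \subset T i]));
  last by move=> T; rewrite -andbA [X in _ && X]andbC.
rewrite (sum_pullback (A := A) (fun T : {ffun 'I_r -> {set V}} => S \subset T i)).
have [SA|SnA] := boolP (S \subset A); last first.
  rewrite big1 ?t_gt0 // => U /and3P[_ UA SU]; case/negP: SnA.
  move: UA; rewrite -bigcup_pushforward => /eqP <-.
  exact: fintype.subset_trans SU (finset.bigcup_sup i _).
pose S' := ((@enum_val V (mem A)) @^-1: S)%SET.
have cardS' : #|S'| = s i.
  by rewrite -cardS -(card_imset _ (@enum_val_inj _ _)) enum_val_preimsetK.
rewrite ltNge; apply/negP => le_t; apply: (c_avoid A i); rewrite /has_target lt_iq.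
exists S' => //; rewrite sum_colour; apply: le_trans le_t _.
rewrite big_mkcond [leRHS]big_mkcond; apply: ler_sum => U _.
have [dU|_] := boolP (disjoint_tuple U); last by [].
have -> : (S \subset tuple_pushforward U i) = (S' \subset U i).
  rewrite ffunE -{1}(enum_val_preimsetK SA).
  apply/fintype.subsetP/fintype.subsetP => [SU x Sx|SU _ /imsetP[x Sx ->]].
    by have := SU _ (imset_f enum_val Sx); rewrite mem_imset //; apply: enum_val_inj.
  by rewrite imset_f // SU.
by case: (_ == _); case: (_ \subset _) => //=; apply: (cP A).1.
Qed.

(** * Existence of an optimal [kweight] *)

(** In a colouring that avoids all targets, each positive tuple covering ['I_a] has, by pigeonhole,
    an entry [T i] with at least [s i] elements, and [i < q] since the graph targets are avoided.
    Charge it to an [s i]-subset [S] of [T i]. Each pair [(i, S)] receives at most [t i], so the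
    total is at most [u], against strictness. *)
Lemma arrows_mixed_exists : exists a u, arrows (kweight a u) mixed_target.
Proof.
pose a := (\sum_i (s i).-1).+1.
pose u := \sum_(i : 'I_r | (i < q)%N) \sum_(S : {set 'I_a} | #|S| == s i) t i.
exists a, u; apply/arrows_mixedP => c cP; apply: contrapT => no.
have no_i i : ~ has_target i (colour c i) by move=> ci; apply: no; exists i.
have [c_ge0 /(_ [set: 'I_a]%SET)] := cP; rewrite /kweight eqxx ltNge => /negP; apply.
pose d (T : {ffun 'I_r -> {set 'I_a}}) i (S : {set 'I_a}) : R :=
  if S \subset T i then c T else 0.
have d_ge0 (T : {ffun 'I_r -> {set 'I_a}}) i S : disjoint_tuple T -> 0 <= d T i S.
  by rewrite /d => /c_ge0; case: ifP.
apply: (@le_trans _ _ (\sum_(T : {ffun 'I_r -> {set 'I_a}} | disjoint_tuple T)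
    \sum_(i : 'I_r | (i < q)%N) \sum_(S : {set 'I_a} | #|S| == s i) d T i S)).
  rewrite big_mkcondr; apply: ler_sum => T dT.
  have sum_ge0 (P : pred 'I_r) (Q : 'I_r -> pred {set 'I_a}) :
      0 <= \sum_(i | P i) \sum_(S | Q i S) d T i S.
    by apply: sumr_ge0 => i _; apply: sumr_ge0 => S _; apply: d_ge0.
  case: eqP => // TT; have := c_ge0 T dT; rewrite le_eqVlt => /orP[/eqP <- //|cT].
  have [i le_i] : exists i, (s i <= #|T i|)%N.
    apply: contrapT => noi; suff : (#|[set: 'I_a]%SET| < a)%N.
      by rewrite cardsT card_ord ltnn.
    rewrite -TT; apply: leq_ltn_trans (card_bigcup_le _) _.
    suff : (\sum_i #|T i| <= \sum_i (s i).-1)%N by rewrite -ltnS.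
    apply: leq_sum => i _; rewrite -ltnS prednK // ltnNge.
    by apply/negP => le_i; apply: noi; exists i.
  have lt_iq : (i < q)%N.
    rewrite ltnNge; apply/negP => le_qi; apply: (no_i i).
    rewrite /has_target ltnNge le_qi /=; exists (T i) => //.
    by apply/(colour_gt0 i _ cP); exists T.
  have [S ST /eqP cardS] := card_subset_exists le_i.
  rewrite (bigD1 i) //= (bigD1 S) //= /d ST -addrA lerDl addr_ge0 //.
  by apply: sumr_ge0 => S' _; apply: d_ge0.
rewrite exchange_big /=; apply: ler_sum => i lt_iq.
rewrite exchange_big /=; apply: ler_sum => S /eqP cardS.
rewrite -big_mkcondr /= -sum_colour leNgt; apply/negP => /ltW le_t.
by apply: (no_i i); rewrite /has_target lt_iq; exists S.
Qed.

(** If no [a] attained the infimum [m], the products with bounded [a] would stay away from [m]; but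
    products near [m] occur only for bounded [a]. *)
Lemma mixed_optimum (i0 : 'I_r) : (i0 < q)%N ->
  exists (a : nat) (u : R), [/\ (0 < a)%N, 0 < u, arrows (kweight a u) mixed_target
    & forall b v, arrows (kweight b v) mixed_target -> a%:R * u <= b%:R * v].
Proof.
move=> lt_i0; have t0_gt0 := t_gt0 lt_i0.
have bound a u : arrows (kweight a u) mixed_target -> (0 < a)%N /\ t i0 <= u.
  (* The sign of [u] is not known yet and [arrows_mixed_ge] asks for a nonnegative weight, hence the
     maximum with [0]. *)
  move=> a_F; have w_ge0 (A : {set 'I_a}) : 0 <= kweight a (Num.max u 0) A.
    by rewrite /kweight; case: ifP; rewrite // le_max lexx orbT.
  have : arrows (kweight a (Num.max u 0)) mixed_target.
    apply: arrows_le a_F => A; rewrite /kweight; case: ifP => // _.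
    by rewrite le_max lexx.
  case/(arrows_mixed_ge lt_i0 w_ge0); rewrite card_ord.
  move=> /(leq_trans (s_gt0 i0)) a_gt0 le_t; split=> //; move: le_t.
  rewrite (bigD1 [set: 'I_a]%SET) //= big1 ?addr0; last first.
    by move=> A /negPf A_neq; rewrite /kweight A_neq.
  by rewrite /kweight eqxx le_max [t i0 <= 0]leNgt t0_gt0 orbF.
pose E : set R := [set x | exists a u,
  arrows (kweight a u) mixed_target /\ x = a%:R * u]%classic.
have E_ge a u : arrows (kweight a u) mixed_target -> a%:R * t i0 <= a%:R * u.
  by move=> /bound[_]; apply: ler_wpM2l.
have E_lb : lbound E (t i0).
  move=> _ [a [u [a_F ->]]]; apply: le_trans (E_ge _ _ a_F).
  by have [a_gt0 _] := bound _ _ a_F; rewrite ler_peMl ?(ltW t0_gt0) // ler1n.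
have E_inf : has_inf E.
  split; last by exists (t i0).
  by have [a [u a_F]] := arrows_mixed_exists; exists (a%:R * u), a, u.
pose m := inf E.
have le_m a u : arrows (kweight a u) mixed_target -> m <= a%:R * u.
  by move=> a_F; apply: ge_inf; [exact: E_inf.2 | exists a, u].
have m_gt0 : 0 < m by apply: lt_le_trans t0_gt0 _; apply: lb_le_inf E_inf.1 E_lb.
suff [a [a_gt0 a_F]] : exists a, (0 < a)%N /\ arrows (kweight a (m / a%:R)) mixed_target.
  exists a, (m / a%:R); split; rewrite ?divr_gt0 ?ltr0n // => b v b_F.
  by rewrite mulrC divfK ?pnatr_eq0 ?gtn_eqF ?le_m // -lt0n.
apply: contrapT => no.
(* By induction, [e] is a minimum of finitely many bounds above [m]; [m + 1] is an arbitrary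
   start. *)
have gap N : exists2 e, m < e &
    forall a u, (a < N)%N -> arrows (kweight a u) mixed_target -> e <= a%:R * u.
  elim: N => [|N [e lt_me e_le]]; first by exists (m + 1); rewrite ?ltrDl.
  have [->|N_gt0] := posnP N.
    exists (m + 1); rewrite ?ltrDl // => a u; rewrite ltnS leqn0 => /eqP -> /bound[].
    by [].
  (* Otherwise there are arrowing values below every [u > m / N], and in the limit [m / N] itself
     arrows. *)
  have [u lt_u u_le] : exists2 u, m / N%:R < u &
      forall v, arrows (kweight N v) mixed_target -> u <= v.
    apply: contrapT => no_u; apply: no; exists N; split=> //.
    apply: arrows_kweight_limit => u lt_u; apply: contrapT => no_v; apply: no_u.
    exists u => // v v_F; rewrite leNgt; apply/negP => lt_vu.
    by apply: no_v; exists v.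
  exists (Num.min e (N%:R * u)).
    by rewrite lt_min lt_me -ltr_pdivrMl ?ltr0n // mulrC.
  move=> a v; rewrite ltnS leq_eqVlt => /orP[/eqP ->|lt_aN] v_F.
    by rewrite ge_min ler_wpM2l ?orbT ?u_le.
  by rewrite ge_min e_le.
(* From this index on, [a * t i0] exceeds [m + 1]. *)
have [e lt_me e_le] := gap (Num.bound ((m + 1) / t i0)).
have [||_ [a [u [a_F ->]]] lt_au] := @inf_adherent _ E (Num.min (e - m) 1).
- by rewrite lt_min subr_gt0 lt_me ltr01.
- exact: E_inf.
have [lt_e lt_m1] : a%:R * u < e /\ a%:R * u < m + 1.
  split; apply: lt_le_trans lt_au _.
    by rewrite -lerBrDl ge_min lexx.
  by rewrite lerD2l ge_min lexx orbT.
suff lt_aN : (a < Num.bound ((m + 1) / t i0))%N.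
  by have := e_le _ _ lt_aN a_F; rewrite leNgt lt_e.
rewrite -(ltr_nat R); apply: lt_trans (archi_boundP _); last first.
  by rewrite divr_ge0 ?(ltW t0_gt0) // addr_ge0 // ltW.
by rewrite ltr_pdivlMr //; apply: le_lt_trans lt_m1; apply: E_ge.
Qed.

End MixedTargets.

(** * The infimum over all weights *)

Theorem theorem6 (R : realType) (r q : nat)
  (hr : (2 <= r)%N) (hq : (1 <= q <= r)%N)
  (s : 'I_r -> nat) (t : 'I_r -> R) (n : 'I_r -> nat)
  (hs : forall i : 'I_r, (0 < s i)%N)
  (ht : forall i : 'I_r, (i < q)%N -> 0 < t i)
  (hn : forall i : 'I_r, (q <= i)%N -> (0 < n i)%N /\ (s i <= n i)%N) :
  let F : 'I_r -> target R := fun i =>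
    if (i < q)%N then WeightTarget (kweight (s i) (t i))
    else GraphTarget (Kmn (s i) (n i)) in
  exists (s0 : nat) (t0 : R),
    [/\ (0 < s0)%N, 0 < t0,
        arrows (kweight s0 t0) F,
        rhat F = (weight_size (kweight s0 t0))%:E
      & weight_size (kweight s0 t0) = s0%:R * t0].
Proof.
move=> F; have r_gt0 : (0 < r)%N := ltnW hr.
(* As [q >= 1], the first target is a weight, which bounds every arrowing [u] from below. *)
have i0_lt : (Ordinal r_gt0 < q)%N by case/andP: hq.
have [a [u [a_gt0 u_gt0 a_F a_min]]] := mixed_optimum hs ht hn i0_lt.
exists a, u; split=> //; last exact: weight_size_kweight.
apply/eqP; rewrite eq_le; apply/andP; split.
  apply: ereal_inf_lbound; exists 'I_a, (kweight a u); split=> //.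
  split=> [|A]; first by rewrite card_ord.
  by rewrite /kweight; case: ifP => // _; apply: ltW.
apply: le_ereal_inf_tmp => _ [V [g [[_ g_ge0] g_F ->]]]; rewrite lee_fin.
rewrite weight_size_kweight; apply: (weight_size_mixed_ge hs ht hn) g_F => //.
by rewrite mulr_gt0 ?ltr0n.
Qed.
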